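(* Let $q$ be a prime power, let $C$ be an $[n,k,d]_q$ linear code such that $C^{\perp}\subseteq C$, and let $c\le n-k+1$ be a positive integer. Then there exists an $[[n+1,\,2k-n-1+c,\,d';\,c]]_q$ EAQECC with $d'\in\{d,d+1\}$ if one of the following conditions holds: (i) $q=2$ and $c$ is odd; (ii) $q=3$ and $3\nmid c$; (iii) $q\ge 4$.
   Context: An $[n,k,d]_q$ linear code is a $k$-dimensional subspace of $\mathbb{F}_q^n$ with minimum Hamming distance $d$. The Euclidean dual is $C^{\perp}=\{v\in\mathbb{F}_q^n : \sum_i v_iw_i=0\ \forall w\in C\}$. An $[[n,k,d;c]]_q$ entanglement-assisted quantum error-correcting code (EAQECC) encodes $k$ logical qudits into $n$ physical qudits using $c$ copies of maximally entangled states pre-shared between sender and receiver. In standard terms: with $\mathcal{H}=\mathbb{C}^q$ and $\Phi=q^{-1/2}\sum_{i}|i\rangle|i\rangle\in\mathcal{H}\otimes\mathcal{H}$, it is a subspace $Q=\{(U\otimes I)(|\psi\rangle\otimes|0\rangle^{\otimes (n-k-c)}\otimes\Phi^{\otimes c}):\psi\in\mathcal{H}^{\otimes k}\}$ of $\mathcal{H}^{\otimes n}\otimes\mathcal{H}^{\otimes c}$, where $U$ is a unitary on the sender's $n$ qudits (the $k$ data qudits, the $n-k-c$ ancillas and the sender's halves of the $c$ pairs) and $I$ acts on the receiver's $c$ halves, such that, with $P$ the orthogonal projector onto $Q$, for every operator $E$ on $\mathcal{H}^{\otimes n}$ acting nontrivially on at most $d-1$ qudits there is a scalar $\lambda_E$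 with $P(E\otimes I)P=\lambda_E P$. *)

(* Defs.v *)
From HB Require Import structures.
From mathcomp Require Import all_boot all_order all_algebra.
From mathcomp Require Import complex mxtens reals.

Set Implicit Arguments.
Unset Strict Implicit.
Unset Printing Implicit Defensive.

Import Order.TTheory GRing.Theory Num.Theory.
Local Open Scope ring_scope.

Section LinearCodes.

Variables (F : finFieldType) (n : nat).
Implicit Type C : {vspace 'rV[F]_n}.

Definition hamming_dist (u v : 'rV[F]_n) : nat :=
  #|[set i : 'I_n | u 0 i != v 0 i]|.

(* No d satisfies this when C has a single word. *)
Definition min_dist C (d : nat) : Prop :=
  (exists u v, [/\ u \in C, v \in C, u != v & hamming_dist u v = d]) /\
  (forall u v, u \in C -> v \in C -> u != v -> (d <= hamming_dist u v)%N).

Definition linear_code C (k d : nat) : Prop := \dim C = k /\ min_dist C d.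

Definition euclidean_dual C : {set 'rV[F]_n} :=
  [set v : 'rV[F]_n | [forall (w : 'rV[F]_n | w \in C), \sum_(i < n) v 0 i * w 0 i == 0]].

End LinearCodes.

(* The labels of the computational basis of (C^q)^{(x) I}, where the finite
   type I indexes the qudits. *)
Definition word (q : nat) (I : finType) := {ffun I -> 'I_q}.

(* Dimension q ^ n of the space of n qudits; the basis vector |x> has index
   enum_rank x and the word of index i is enum_val i. *)
Notation qdim q n := #|{: word q 'I_n}|.

(* A vector of H^{(x) n} (x) H^{(x) c} is a row of length qdim q n * qdim q c,
   with mxtens_index as the pairing of indices, and operators multiply rows on
   the right: the matrices are the transposes of those acting on columns.
   A subspace is the row space of a matrix. *)
Section EAQECC.

Variables (K : numClosedFieldType) (q : nat).

Definition restrict (I : finType) (S : {set I}) (x : word q I) :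
    word q {i : I | i \in S} :=
  [ffun i => x (val i)].

(* E = A (x) I for an operator A on the qudits in S and the identity I on the
   other ones. *)
Definition acts_on (n : nat) (S : {set 'I_n}) (E : 'M[K]_(qdim q n)) : Prop :=
  exists A : word q {i | i \in S} -> word q {i | i \in S} -> K,
  forall x y : word q 'I_n,
    E (enum_rank x) (enum_rank y) =
      A (restrict S x) (restrict S y) * (restrict (~: S) x == restrict (~: S) y)%:R.

(* The amplitude <a b|Phi> for Phi = q^{-1/2} sum_i |i>|i>. *)
Definition Phi (a b : 'I_q) : K := (sqrtC q%:R)^-1 * (a == b)%:R.

(* psi (x) |0>^{(x) a} (x) Phi^{(x) c}. The sender's n = k + a + c qudits are,
   in this order, the data, the ancillas and the sender's halves of the pairs. *)
Definition initial_state (n k a c : nat) (e : (k + a + c = n)%N)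
    (psi : 'rV[K]_(qdim q k)) : 'rV[K]_(qdim q n * qdim q c) :=
  \row_l
    let x : word q 'I_n := enum_val (mxtens_unindex l).1 in
    let y : word q 'I_c := enum_val (mxtens_unindex l).2 in
    let data : word q 'I_k := [ffun i => x (cast_ord e (lshift c (lshift a i)))] in
    psi 0 (enum_rank data)
    * (\prod_(i < a) (val (x (cast_ord e (lshift c (rshift k i)))) == 0%N)%:R)
    * (\prod_(j < c) Phi (x (cast_ord e (rshift (k + a) j))) (y j)).

(* Q is an [[n, k, d; c]]_q code; as usual for quantum codes, this asks for
   detection of the errors of weight at most d - 1, not for the maximality of
   d. *)
Definition EAQECC (n k d c : nat) (Q : 'M[K]_(qdim q n * qdim q c)) : Prop :=
  (exists (a : nat) (e : (k + a + c = n)%N) (U : 'M[K]_(qdim q n)),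
     U \is unitarymx /\
     forall v : 'rV[K]_(qdim q n * qdim q c),
       (v <= Q)%MS <->
       exists psi : 'rV[K]_(qdim q k), v = initial_state e psi *m (U *t 1%:M)) /\
  (forall (S : {set 'I_n}) (E : 'M[K]_(qdim q n)),
     (#|S| <= d - 1)%N -> acts_on S E ->
     exists lambda : K,
       proj_ortho Q *m (E *t 1%:M) *m proj_ortho Q = lambda *: proj_ortho Q).

End EAQECC.

(* Main.v *)
(* Let H be a parity-check matrix of C, so that its rows span D = C^perp, a
   subspace of C, and let r = n - k. If A and B are subspaces of F^(n+1) such
   that the nonzero words of A, and those orthogonal to B, have weight at least
   d, then the states
     |psi_x> = sum_(u, y) |x X + u W + y Y> |y>,
   where W, (X, W) and (W, Y) are bases of A :&: B, A and B, span an
   entanglement-assisted code with dim B - dim (A :&: B) maximally entangled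
   pairs. An error on fewer than d qudits cannot move one word of A to another,
   which kills the off-diagonal terms, and B restricts onto fewer than d
   coordinates, so the diagonal terms do not depend on x. This is the CSS
   construction, and d' = d is enough.

   It remains to find A of dimension k and B of dimension r + 1 with
   dim (A :&: B) = r + 1 - c. Permute the coordinates of D inside an
   information set of D by a permutation pi. As D is orthogonal to itself, the
   intersection of C with the permuted code is the space of information vectors
   fixed by pi, whose dimension is the number t of orbits of pi; every t from 1
   to r occurs. Extending C by 0 (A is extended_code) and the permuted D by an
   independent last coordinate (B is extended_dual) gives every c <= r. For
   c = r + 1 take for pi a full cycle, and extend by a word h outside the sum of
   C and the permuted D, and by a functional f that does not vanish on their
   intersection. *)
From mathcomp Require Import all_boot all_order all_algebra.
From mathcomp Require Import complex mxtens reals.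
From mathcomp Require Import fingroup perm ring zify.
Require Import Defs.

Set Implicit Arguments.
Unset Strict Implicit.
Unset Printing Implicit Defensive.

Import Order.TTheory GRing.Theory Num.Theory.
Local Open Scope ring_scope.
Local Open Scope sesquilinear_scope.

(** * Orthonormal families and orthogonal projectors *)

Section Unitary.
Variable K : numClosedFieldType.

(** On a rectangular matrix [unitarymx] means orthonormal rows; Gram-Schmidt on a basis of their
    orthogonal complement supplies the missing ones. *)
Lemma unitarymx_complete m n (V : 'M[K]_(m, n)) :
  V \is unitarymx -> exists R : 'M[K]_(n - m, n), col_mx V R \is unitarymx.
Proof.
move=> Vu; pose Vo := orthomx Num.conj (mx_of_hermitian (@hermitian1mx K n)) V.
have rkVo : \rank Vo = (n - m)%N by rewrite rank_ortho mxrank_unitary.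
pose R := schmidt (row_base Vo).
have Ru : R \is unitarymx by rewrite schmidt_unitarymx ?rank_leq_col.
have RVo : (R <= Vo)%MS by rewrite eqmx_schmidt_free ?eq_row_base ?row_base_free.
move: R Ru RVo; rewrite rkVo => R Ru RVo.
exists R; apply/unitarymxP; rewrite tr_col_mx map_row_mx mul_col_row.
have VR : V *m R ^t* = 0 by apply/orthomx1P; rewrite orthomx_sym.
by rewrite (unitarymxP Vu) (unitarymxP Ru) (orthomx1P RVo) VR -scalar_mx_block.
Qed.

(** Both families extend to orthonormal bases, and [U] is the change of basis. This is the source of
    the encoding unitary. *)
Lemma unitarymx_transitive m n (J V : 'M[K]_(m, n)) :
    J \is unitarymx -> V \is unitarymx ->
  exists2 U : 'M[K]_n, U \is unitarymx & J *m U = V.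
Proof.
move=> Ju Vu; have [R JRu] := unitarymx_complete Ju.
have [S VSu] := unitarymx_complete Vu.
have mn : (m + (n - m))%N = n.
  by rewrite subnKC // -(mxrank_unitary Ju) rank_leq_col.
pose U := (col_mx J R) ^t* *m col_mx V S.
have JU : col_mx J R *m U = col_mx V S.
  by rewrite mulmxA (unitarymxP JRu) mul1mx.
exists U.
  apply/unitarymxP; rewrite trmx_mul map_mxM trmxCK -/U mulmxA.
  rewrite /U -!mulmxA (mulmxA (col_mx V S)) (unitarymxP VSu) mul1mx.
  by rewrite -[LHS]mul1mx mulmxA mulmxKtV.
by move: JU; rewrite mul_col_mx => /eq_col_mx[].
Qed.

Lemma proj_ortho_unitary p m n (Q : 'M[K]_(p, n)) (B : 'M[K]_(m, n)) :
  (Q :=: B)%MS -> B \is unitarymx -> proj_ortho Q = B ^t* *m B.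
Proof.
move=> QB Bu; have /submxP[D BD] : (proj_ortho Q <= B)%MS.
  by rewrite -QB proj_orthoE.
rewrite BD; congr (_ *m _).
(* The rows of [1%:M - B ^t* *m B] are orthogonal to those of [B], so the projector kills them,
   while it fixes [B]. *)
have : ((1%:M - B ^t* *m B) *m proj_ortho Q) = 0.
  apply: proj_ortho_0; rewrite (eqmx_ortho _ QB); apply/orthomx1P.
  by rewrite mulmxBl mul1mx -mulmxA (unitarymxP Bu) mulmx1 subrr.
rewrite mulmxBl mul1mx -mulmxA (proj_ortho_id (_ : (B <= Q)%MS)) ?QB //.
move/(congr1 (mulmx^~ (B ^t*))); rewrite mul0mx mulmxBl BD -!mulmxA.
by rewrite (unitarymxP Bu) !mulmx1 => /subr0_eq.
Qed.

End Unitary.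

(** * Uniform superpositions of basis states *)

Lemma sum_delta (R : pzRingType) (Z : finType) (f : Z -> R) (a : Z) :
  \sum_z f z * (z == a)%:R = f a.
Proof.
by rewrite (bigD1 a) //= eqxx mulr1 big1 ?addr0 // => z /negPf->; rewrite mulr0.
Qed.

Section Superposition.
Variable K : numClosedFieldType.

Lemma sum_enum_rank (Z : finType) (f : 'I_#|Z| -> K) :
  \sum_i f i = \sum_z f (enum_rank z).
Proof.
by rewrite (reindex (@enum_rank Z)) //; apply: onW_bij; apply: enum_rank_bij.
Qed.

Lemma sum_mxtens_index (Z Y : finType) (f : 'I_(#|Z| * #|Y|) -> K) :
  \sum_l f l = \sum_z \sum_y f (mxtens_index (enum_rank z, enum_rank y)).
Proof.
rewrite (reindex (@mxtens_index #|Z| #|Y|)) /=; last first.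
  by exists (@mxtens_unindex _ _) => l _; rewrite ?mxtens_indexK ?mxtens_unindexK.
rewrite (eq_bigr (fun p => f (mxtens_index (p.1, p.2)))) => [|[] //].
rewrite -(pair_bigA _ (fun i j => f (mxtens_index (i, j)))) /= sum_enum_rank.
by apply: eq_bigr => z _; rewrite sum_enum_rank.
Qed.

Lemma inv_sqrtC_nat_ge0 (m : nat) : 0 <= (sqrtC m%:R)^-1 :> K.
Proof. by rewrite invr_ge0 sqrtC_ge0 ler0n. Qed.

(** Used twice: with a one-point [T] for the basis states fed to the encoder, and with a general [T]
    for their images. *)
Definition superpositions (P T Z : finType) (G : P -> T -> Z) :
    'M[K]_(#|P|, #|Z|) :=
  \matrix_(i, l) ((sqrtC #|T|%:R)^-1
                  * \sum_u (enum_val l == G (enum_val i) u)%:R).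

Lemma superpositions_unitary (P T Z : finType) (G : P -> T -> Z) :
    (0 < #|T|)%N -> (forall p p' u u', G p u = G p' u' -> p = p' /\ u = u') ->
  superpositions G \is unitarymx.
Proof.
move=> T_gt0 injG; apply/unitarymxP/matrixP => i j.
rewrite -(enum_valK i) -(enum_valK j); move: (enum_val i) (enum_val j) => p p'.
rewrite !mxE sum_enum_rank (inj_eq enum_rank_inj).
transitivity (#|T|%:R^-1 * \sum_u \sum_u' (G p u == G p' u')%:R : K).
  pose b : K := (sqrtC #|T|%:R)^-1.
  have bb : b * b^* = #|T|%:R^-1.
    by rewrite geC0_conj ?inv_sqrtC_nat_ge0 // -expr2 exprVn sqrtCK.
  transitivity (\sum_z \sum_u (b * b^* * \sum_u' (z == G p' u')%:R)
                              * (z == G p u)%:R).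
    apply: eq_bigr => z _; rewrite !mxE !enum_rankK rmorphM /= -/b.
    have -> : (\sum_u (z == G p' u)%:R)^* = \sum_u (z == G p' u)%:R :> K.
      by rewrite rmorph_sum; apply: eq_bigr => u _; apply: conjC_nat.
    by rewrite -mulr_sumr; ring.
  by rewrite exchange_big mulr_sumr; apply: eq_bigr => u _; rewrite sum_delta bb.
case: eqP => [<-|pp']; last first.
  rewrite big1 ?mulr0 // => u _; rewrite big1 // => u' _.
  by case: eqP => // /injG[].
rewrite (eq_bigr (fun=> 1)) => [|u _]; last first.
  rewrite -[RHS](sum_delta (fun=> 1) u); apply: eq_bigr => u' _.
  rewrite mul1r eq_sym; congr (_%:R); congr nat_of_bool.
  by apply/eqP/eqP => [/injG[]|->].
by rewrite sumr_const mulVf // pnatr_eq0 -lt0n.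
Qed.

End Superposition.

(** * The encoder, its unitary and its error detection *)

Section Encoding.
Variables (K : numClosedFieldType) (q : nat) (q_gt0 : (0 < q)%N).
Variables (N k a c : nat) (e : (k + a + c = N)%N).

Definition data_word (z : word q 'I_N) : word q 'I_k :=
  [ffun i => z (cast_ord e (lshift c (lshift a i)))].

(** The only word of the sender that can have a nonzero amplitude next to data [x] and the
    receiver's word [y]; see [initial_stateE]. *)
Definition input_word (x : word q 'I_k) (y : word q 'I_c) : word q 'I_N :=
  [ffun i => match split (cast_ord (esym e) i) with
             | inl j => match split j with
                        | inl i' => x i'
                        | inr _ => Ordinal q_gt0
                        end
             | inr j => y j
             end].

Lemma input_wordL x y i :
  input_word x y (cast_ord e (lshift c (lshift a i))) = x i.
Proof. by rewrite ffunE cast_ordK !(unsplitK (inl _)). Qed.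

Lemma input_wordM x y i :
  input_word x y (cast_ord e (lshift c (rshift k i))) = Ordinal q_gt0.
Proof. by rewrite ffunE cast_ordK (unsplitK (inl _)) (unsplitK (inr _)). Qed.

Lemma input_wordR x y i : input_word x y (cast_ord e (rshift (k + a) i)) = y i.
Proof. by rewrite ffunE cast_ordK (unsplitK (inr _)). Qed.

Lemma data_input_word x y : data_word (input_word x y) = x.
Proof. by apply/ffunP => i; rewrite ffunE input_wordL. Qed.

Lemma input_word_inj x x' y y' :
  input_word x y = input_word x' y' -> x = x' /\ y = y'.
Proof.
move=> E; split; first by rewrite -(data_input_word x y) E data_input_word.
by apply/ffunP => i; rewrite -(input_wordR x) E input_wordR.
Qed.

Lemma prod_natb (I : finType) (P : pred I) :
  \prod_i (P i)%:R = [forall i, P i]%:R :> K.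
Proof.
case: forallP => [allP|]; first by rewrite big1 // => i _; rewrite allP.
move=> /forallP; rewrite negb_forall => /existsP[i /negPf Pi].
by rewrite (bigD1 i) //= Pi mul0r.
Qed.

Lemma initial_stateE (psi : 'rV[K]_(qdim q k)) z (y : word q 'I_c) :
  initial_state e psi 0 (mxtens_index (enum_rank z, enum_rank y))
  = (sqrtC q%:R)^-1 ^+ c * psi 0 (enum_rank (data_word z))
    * (z == input_word (data_word z) y)%:R.
Proof.
have -> : (z == input_word (data_word z) y)
    = [forall i, val (z (cast_ord e (lshift c (rshift k i)))) == 0%N]
      && [forall j, z (cast_ord e (rshift (k + a) j)) == y j].
  apply/eqP/andP => [->|[/forallP z0 /forallP zy]].
    by split; apply/forallP => i; rewrite ?input_wordM ?input_wordR.
  apply/ffunP => i; rewrite -(cast_ordKV e i).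
  case: (split_ordP (cast_ord (esym e) i)) => j ->; last first.
    by rewrite input_wordR (eqP (zy j)).
  case: (split_ordP j) => l ->; first by rewrite input_wordL ffunE.
  by rewrite input_wordM; apply/val_inj/eqP/z0.
rewrite mxE mxtens_indexK /= !enum_rankK -/(data_word z) !prod_natb.
rewrite /Phi big_split /= prodr_const card_ord prod_natb -mulnb natrM; ring.
Qed.

Variables (T : finType) (t0 : T).
Variable g : word q 'I_k -> T -> word q 'I_c -> word q 'I_N.

Let amplitude : K := (sqrtC q%:R)^-1 ^+ c * (sqrtC #|T|%:R)^-1.

(** Row [x] is a code state: the normalised sum of [|g x u y>|y>] over all [u] and [y]. Later
    [g x u y] is the word of [x X + u W + y Y]. *)
Definition encoder : 'M[K]_(qdim q k, qdim q N * qdim q c) :=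
  \matrix_(i, l) (amplitude
    * \sum_u (enum_val (mxtens_unindex l).1
              == g (enum_val i) u (enum_val (mxtens_unindex l).2))%:R).

Lemma encoderE x z y :
  encoder (enum_rank x) (mxtens_index (enum_rank z, enum_rank y))
  = amplitude * \sum_u (z == g x u y)%:R.
Proof. by rewrite mxE mxtens_indexK /= !enum_rankK. Qed.

Hypothesis g_inj : forall x x' u u' y y',
  g x u y = g x' u' y' -> [/\ x = x', u = u' & y = y'].

(** For fixed [x] and [y], the input word and the superposition of the [g x u y] over [u] form two
    orthonormal families indexed by [(x, y)]. A unitary on the sender's side alone carries one to
    the other. *)
Lemma encoder_unitary_image :
  exists2 U : 'M[K]_(qdim q N), U \is unitarymx &
    forall psi, initial_state e psi *m (U *t 1%:M) = psi *m encoder.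
Proof.
pose J := @superpositions K _ unit _ (fun p _ => input_word p.1 p.2).
pose V := @superpositions K _ T _ (fun p u => g p.1 u p.2).
have Ju : J \is unitarymx.
  apply: superpositions_unitary; first by rewrite card_unit.
  by move=> [x y] [x' y'] [] [] /= /input_word_inj[-> ->].
have Vu : V \is unitarymx.
  apply: superpositions_unitary; first by apply/card_gt0P; exists t0.
  by move=> [x y] [x' y'] u u' /= /g_inj[-> -> ->].
have [U Uu JU] := unitarymx_transitive Ju Vu; exists U => // psi.
have rowU x y z : U (enum_rank (input_word x y)) (enum_rank z)
    = (sqrtC #|T|%:R)^-1 * \sum_u (z == g x u y)%:R.
  move/matrixP/(_ (enum_rank (x, y)) (enum_rank z)): JU.
  rewrite [RHS]mxE !enum_rankK /= => <-; rewrite mxE sum_enum_rank.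
  rewrite (bigD1 (input_word x y)) //= big1 ?addr0 => [|w /negPf wxy].
    rewrite mxE !enum_rankK card_unit sqrtC1 invr1 mul1r big_const card_unit /=.
    by rewrite eqxx addr0 mul1r.
  by rewrite mxE !enum_rankK big1 ?mulr0 ?mul0r // => ? _; rewrite /= wxy.
apply/rowP => l; case: (mxtens_indexP l) => i j.
rewrite -(enum_valK i) -(enum_valK j); move: (enum_val i) (enum_val j) => z y {i j l}.
rewrite mxE sum_mxtens_index [RHS]mxE sum_enum_rank.
pose input w y' := initial_state e psi 0 (mxtens_index (enum_rank w, enum_rank y')).
(* The identity on the receiver's side forces [y' = y]. *)
transitivity (\sum_w input w y * U (enum_rank w) (enum_rank z)).
  apply: eq_bigr => w _.
  rewrite -[RHS](sum_delta (fun y' => input w y' * U (enum_rank w) (enum_rank z))).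
  apply: eq_bigr => y' _.
  by rewrite tensmxE [1%:M _ _]mxE (inj_eq enum_rank_inj) mulrA.
rewrite (bigID (fun w => w == input_word (data_word w) y)) /= addrC.
rewrite big1 ?add0r => [|w /negPf wxy]; last first.
  by rewrite /input initial_stateE wxy mulr0 mul0r.
(* Only input words are left, and their data index them. *)
rewrite (reindex_onto (input_word^~ y) data_word) => [|w /eqP <- //].
rewrite (eq_bigl predT) => [|x]; last by rewrite data_input_word !eqxx.
apply: eq_bigr => x _.
rewrite /input initial_stateE data_input_word eqxx mulr1 rowU encoderE.
rewrite /amplitude; ring.
Qed.

(** The receiver's qudits are untouched, so only pairs of terms with the same [y] contribute. *)
Lemma encoder_conj (E : 'M[K]_(qdim q N)) x x' :
  (encoder *m (E *t 1%:M) *m encoder ^t*) (enum_rank x) (enum_rank x')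
  = (q ^ c * #|T|)%:R^-1 * \sum_u \sum_u' \sum_y
      E (enum_rank (g x u y)) (enum_rank (g x' u' y)).
Proof.
have amp_real : amplitude^* = amplitude.
  by rewrite geC0_conj // mulr_ge0 ?exprn_ge0 ?inv_sqrtC_nat_ge0.
have amp2 : amplitude * amplitude = (q ^ c * #|T|)%:R^-1.
  by rewrite -expr2 /amplitude exprMn exprAC !exprVn !sqrtCK natrM natrX invfM.
have encE z y : (encoder *m (E *t 1%:M)) (enum_rank x)
    (mxtens_index (enum_rank z, enum_rank y))
    = amplitude * \sum_u E (enum_rank (g x u y)) (enum_rank z).
  rewrite mxE sum_mxtens_index exchange_big /=.
  transitivity (\sum_y' (\sum_w
      encoder (enum_rank x) (mxtens_index (enum_rank w, enum_rank y'))
      * E (enum_rank w) (enum_rank z)) * (y' == y)%:R).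
    apply: eq_bigr => y' _; rewrite mulr_suml; apply: eq_bigr => w _.
    by rewrite tensmxE [1%:M _ _]mxE (inj_eq enum_rank_inj) mulrA.
  rewrite sum_delta.
  transitivity (amplitude
      * \sum_u \sum_w E (enum_rank w) (enum_rank z) * (w == g x u y)%:R).
    rewrite exchange_big mulr_sumr; apply: eq_bigr => w _.
    by rewrite encoderE -mulr_sumr; ring.
  by congr (_ * _); apply: eq_bigr => u _; rewrite sum_delta.
rewrite mxE sum_mxtens_index exchange_big /= -amp2.
transitivity (amplitude * amplitude * \sum_y \sum_u \sum_u' \sum_z
    E (enum_rank (g x u y)) (enum_rank z) * (z == g x' u' y)%:R).
  rewrite mulr_sumr; apply: eq_bigr => y _.
  rewrite (eq_bigr _ (fun u _ => exchange_big _ _ _ _ _ _)) exchange_big mulr_sumr /=.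
  apply: eq_bigr => z _; rewrite encE !mxE mxtens_indexK /= !enum_rankK.
  have -> : (amplitude * \sum_u (z == g x' u y)%:R)^*
      = amplitude * \sum_u (z == g x' u y)%:R.
    rewrite rmorphM /= amp_real rmorph_sum /=; congr (_ * _).
    by apply: eq_bigr => u _; apply: conjC_nat.
  rewrite (eq_bigr _ (fun u _ => esym (mulr_sumr _ _ _ _))) -mulr_suml; ring.
congr (_ * _); rewrite exchange_big; apply: eq_bigr => u _ /=.
rewrite exchange_big; apply: eq_bigr => u' _ /=.
by apply: eq_bigr => y _; rewrite sum_delta.
Qed.

Variable d : nat.

Hypothesis g_sep : forall (S : {set 'I_N}) x x' u u' y, (#|S| <= d - 1)%N ->
  restrict (~: S) (g x u y) = restrict (~: S) (g x' u' y) -> x = x' /\ u = u'.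

Hypothesis g_hide : forall (S : {set 'I_N}) x x', (#|S| <= d - 1)%N ->
  exists2 tau : T * word q 'I_c -> T * word q 'I_c, injective tau &
    forall p, restrict S (g x' (tau p).1 (tau p).2) = restrict S (g x p.1 p.2).

(** An entry of [E] vanishes unless its two words agree off [S], so [g_sep] leaves only the terms
    with [x = x'] and [u = u']. These depend on the restriction to [S] alone, and reindexing by the
    bijection [tau] of [g_hide] replaces [x] by [x0]. *)
Lemma encoder_detects (S : {set 'I_N}) (E : 'M[K]_(qdim q N)) x0 :
    (#|S| <= d - 1)%N -> acts_on S E ->
  encoder *m (E *t 1%:M) *m encoder ^t*
  = ((q ^ c * #|T|)%:R^-1 * \sum_u \sum_y
      E (enum_rank (g x0 u y)) (enum_rank (g x0 u y)))%:M.
Proof.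
move=> Sd [A EA]; apply/matrixP => i j.
rewrite -(enum_valK i) -(enum_valK j); move: (enum_val i) (enum_val j) => x x'.
rewrite encoder_conj [RHS]mxE (inj_eq enum_rank_inj); case: eqP => [<-|xx'].
  rewrite mulr1n; congr (_ * _).
  transitivity (\sum_u \sum_y E (enum_rank (g x u y)) (enum_rank (g x u y))).
    apply: eq_bigr => u _; rewrite (bigD1 u) //= [X in _ + X]big1 ?addr0 // => u' uu'.
    apply: big1 => y _; rewrite EA; case: eqP => [/g_sep[//|_]|]; last by rewrite mulr0.
    by move=> uE; rewrite uE eqxx in uu'.
  rewrite !pair_bigA /=; have [tau tau_inj tauE] := g_hide x x0 Sd.
  rewrite [RHS](reindex_inj tau_inj) /=; apply: eq_bigr => p _.
  by rewrite !EA !eqxx tauE.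
rewrite mulr0n big1 ?mulr0 // => u _; rewrite big1 // => u' _; rewrite big1 // => y _.
by rewrite EA; case: eqP => [/g_sep[//|]|]; last by rewrite mulr0.
Qed.

(** Orthonormality is the detection of the identity, seen as an operator on the empty set of qudits;
    the scalar is then 1. *)
Lemma encoder_unitary : encoder \is unitarymx.
Proof.
apply/unitarymxP; pose x0 : word q 'I_k := [ffun=> Ordinal q_gt0].
have act1 : acts_on set0 (1%:M : 'M[K]_(qdim q N)).
  exists (fun _ _ => 1) => x y; rewrite mxE mul1r (inj_eq enum_rank_inj).
  congr (_%:R); congr nat_of_bool; apply/eqP/eqP => [-> //|/ffunP xy].
  apply/ffunP => i; have iS : i \in ~: set0 by rewrite !inE.
  by have := xy (exist _ i iS); rewrite !ffunE.
have := encoder_detects x0 _ act1; rewrite cards0 => /(_ isT).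
have -> : 1%:M *t 1%:M = 1%:M :> 'M[K]_(qdim q N * qdim q c).
  apply/matrixP => l l'; case: (mxtens_indexP l) => i j.
  case: (mxtens_indexP l') => i' j'.
  rewrite tensmxE !mxE -natrM mulnb (can_eq (@mxtens_indexK _ _)).
  by rewrite -xpair_eqE.
rewrite mulmx1 => ->; congr (_%:M).
rewrite (eq_bigr (fun=> (q ^ c)%:R)) => [|u _]; last first.
  rewrite (eq_bigr (fun=> 1)) => [|y _]; last by rewrite mxE eqxx.
  by rewrite sumr_const card_ffun !card_ord.
rewrite sumr_const -mulrnA mulVf // pnatr_eq0.
by rewrite -lt0n muln_gt0 expn_gt0 q_gt0; apply/card_gt0P; exists t0.
Qed.

Lemma EAQECC_encoder : exists Q, @EAQECC K q N k d c Q.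
Proof.
pose Q : 'M[K]_(qdim q N * qdim q c) := <<encoder>>%MS.
have QE : (Q :=: encoder)%MS by apply: genmxE.
have [U Uu initU] := encoder_unitary_image.
exists Q; split.
  exists a, e, U; split=> // v; rewrite QE; split=> [/submxP[psi ->]|[psi ->]].
    by exists psi; rewrite initU.
  by rewrite initU submxMl.
move=> S E Sd SE; pose x0 : word q 'I_k := [ffun=> Ordinal q_gt0].
have := encoder_detects x0 Sd SE; set lambda := _ * _ => BEB.
exists lambda; rewrite (proj_ortho_unitary QE encoder_unitary).
(* The projector is [B ^t* *m B] with [B] the encoder, and the factor in parentheses is scalar. *)
transitivity (encoder ^t* *m (encoder *m (E *t 1%:M) *m encoder ^t*) *m encoder).
  by rewrite !mulmxA.
by rewrite BEB mul_mx_scalar -scalemxAl.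
Qed.

End Encoding.

(** * Words as vectors over a field, and the CSS construction *)

Section WordsOfVectors.
Variables (F : finFieldType) (n : nat).

Definition word_vec (x : word #|F| 'I_n) : 'rV[F]_n := \row_i enum_val (x i).

Definition vec_word (v : 'rV[F]_n) : word #|F| 'I_n :=
  [ffun i => enum_rank (v 0 i)].

Lemma word_vecK : cancel word_vec vec_word.
Proof. by move=> x; apply/ffunP => i; rewrite ffunE mxE enum_valK. Qed.

Lemma vec_wordK : cancel vec_word word_vec.
Proof. by move=> v; apply/rowP => i; rewrite mxE ffunE enum_rankK. Qed.

Lemma restrict_vec_word (S : {set 'I_n}) (u v : 'rV[F]_n) :
  restrict S (vec_word u) = restrict S (vec_word v) <->
  {in S, forall i, u 0 i = v 0 i}.
Proof.
split=> [uv i iS|uv].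
  have /ffunP/(_ (exist _ i iS)) := uv; rewrite !ffunE /=; exact: enum_rank_inj.
by apply/ffunP => -[i iS]; rewrite !ffunE /= uv.
Qed.

Definition weight (v : 'rV[F]_n) : nat := #|[set i | v 0 i != 0]|.

Lemma weight_supp (S : {set 'I_n}) (v : 'rV[F]_n) :
  {in ~: S, forall i, v 0 i = 0} -> (weight v <= #|S|)%N.
Proof.
move=> vS; apply/subset_leq_card/subsetP => i; rewrite inE.
by apply: contraNT => iS; rewrite vS // inE.
Qed.

(** Duality: a linear relation between the coordinates in [S] of all the rows of [D] is a vector
    supported in [S] and orthogonal to [D]. *)
Lemma restriction_onto s (D : 'M[F]_(s, n)) (S : {set 'I_n}) :
    (forall v : 'rV_n, {in ~: S, forall i, v 0 i = 0} -> v *m D^T = 0 -> v = 0) ->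
  forall z : 'rV_n, exists u : 'rV_s, {in S, forall i, (u *m D) 0 i = z 0 i}.
Proof.
move=> DS z; pose Delta : 'M[F]_n := diag_mx (\row_i (i \in S)%:R).
have DeltaE (v : 'rV_n) i : (v *m Delta) 0 i = v 0 i * (i \in S)%:R.
  by rewrite mul_mx_diag !mxE.
(* [Delta] erases the coordinates outside [S], so each column of this product is supported in [S]
   and orthogonal to [D]. *)
have Delta0 : Delta *m cokermx (D *m Delta) = 0.
  apply/trmx_inj/row_matrixP => j; rewrite trmx0 row0 -tr_col; apply: DS => [i|].
    by rewrite inE mxE colE -mulmxA mul_diag_mx !mxE => /negPf->; rewrite mul0r.
  apply/trmx_inj; rewrite trmx_mul !trmxK trmx0 colE mulmxA (mulmxA D) mulmx_coker.
  by rewrite mul0mx.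
have /submxP[u uE] : (z *m Delta <= D *m Delta)%MS.
  by rewrite submxE -mulmxA Delta0 mulmx0.
exists u => i iS; have /rowP/(_ i) := uE.
by rewrite mulmxA !DeltaE iS !mulr1.
Qed.

End WordsOfVectors.

(** Independence of all the rows gives [g_inj], the distance of [(X, W)] gives [g_sep], and that of
    the dual of [(W, Y)] gives [g_hide]. *)
Lemma EAQECC_matrices (K : numClosedFieldType) (F : finFieldType)
    (N k w c a d : nat) (e : (k + a + c = N)%N)
    (X : 'M[F]_(k, N)) (W : 'M[F]_(w, N)) (Y : 'M[F]_(c, N)) :
    (0 < d)%N -> row_free (col_mx (col_mx X W) Y) ->
    (forall v : 'rV_N, (v <= col_mx X W)%MS -> (weight v < d)%N -> v = 0) ->
    (forall v : 'rV_N, v *m (col_mx W Y)^T = 0 -> (weight v < d)%N -> v = 0) ->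
  exists Q, @EAQECC K #|F| N k d c Q.
Proof.
move=> d_gt0 /row_free_inj XWY_inj XW_d WY_d.
have q_gt0 : (0 < #|F|)%N by apply/card_gt0P; exists 0.
have comb_inj (x x' : 'rV_k) (u u' : 'rV_w) (y y' : 'rV_c) :
    x *m X + u *m W + y *m Y = x' *m X + u' *m W + y' *m Y ->
  [/\ x = x', u = u' & y = y'].
  move=> xuy; have : row_mx (row_mx x u) y = row_mx (row_mx x' u') y'.
    by apply: XWY_inj; rewrite !mul_row_col.
  by case/eq_row_mx => /eq_row_mx[-> ->] ->.
pose g x (u : 'rV[F]_w) y :=
  vec_word (word_vec x *m X + u *m W + word_vec y *m Y).
have supp_lt (S : {set 'I_N}) (v : 'rV[F]_N) : (#|S| <= d - 1)%N ->
    {in ~: S, forall i, v 0 i = 0} -> (weight v < d)%N.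
  by move=> Sd /weight_supp vS; lia.
apply: (@EAQECC_encoder K #|F| q_gt0 N k a c e _ (0 : 'rV[F]_w) g).
- move=> x x' u u' y y' /(can_inj (@vec_wordK _ _)) /comb_inj[].
  by move=> /(can_inj (@word_vecK _ _))-> -> /(can_inj (@word_vecK _ _))->.
- move=> S x x' u u' y Sd /restrict_vec_word xu.
  (* The two words share [y], so their difference lies in the span of [X] and [W]. *)
  pose v := word_vec x *m X + u *m W - (word_vec x' *m X + u' *m W).
  have v0 : v = 0.
    apply: XW_d; last first.
      apply: (supp_lt S) => // i /xu; rewrite !mxE => xuy; apply/eqP.
      by rewrite subr_eq0; apply/eqP; apply: addIr xuy.
    by rewrite /v -!mul_row_col addmx_sub ?eqmx_opp ?submxMl.
  have /subr0_eq xuE := v0.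
  have [|/(can_inj (@word_vecK _ _))-> -> //] :=
    comb_inj (word_vec x) (word_vec x') u u' 0 0.
  by rewrite xuE.
- move=> S x x' Sd; pose z := word_vec x *m X - word_vec x' *m X.
  have [|uy uyE] := @restriction_onto _ _ _ (col_mx W Y) S _ z.
    by move=> v vS vD; apply: WY_d => //; apply: supp_lt vS.
  move: uyE; rewrite -[uy]hsubmxK mul_row_col.
  move: (lsubmx uy) (rsubmx uy) => u0 y0 uyE.
  (* On [S], the change of data is a combination of [W] and [Y] with coefficients [u0] and [y0];
     translating by them compensates for it. *)
  exists (fun p => (p.1 + u0, vec_word (word_vec p.2 + y0))).
    move=> [u y] [u' y'] /= [] /addIr -> /(can_inj (@vec_wordK _ _)) /addIr.
    by move=> /(can_inj (@word_vecK _ _))->.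
  move=> [u y] /=; apply/restrict_vec_word => i iS; rewrite vec_wordK.
  have := uyE i iS; rewrite !mulmxDl !mxE => E.
  rewrite -(subrK (\sum_j word_vec x' 0 j * X j i)
                  (\sum_j word_vec x 0 j * X j i)) -E.
  by ring.
Qed.

Lemma eqmx_basis (F : fieldType) m n p (A : 'M[F]_(m, n)) :
  \rank A = p -> exists B : 'M[F]_(p, n), (B :=: A)%MS.
Proof. by move=> <-; exists (row_base A); apply: eq_row_base. Qed.

Lemma EAQECC_codes (K : numClosedFieldType) (F : finFieldType)
    (N k w c a d m1 m2 : nat) (e : (k + a + c = N)%N)
    (C : 'M[F]_(m1, N)) (D : 'M[F]_(m2, N)) :
    (0 < d)%N -> \rank C = (k + w)%N -> \rank D = (w + c)%N ->
    \rank (C :&: D)%MS = w ->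
    (forall v : 'rV_N, (v <= C)%MS -> (weight v < d)%N -> v = 0) ->
    (forall v : 'rV_N, v *m D^T = 0 -> (weight v < d)%N -> v = 0) ->
  exists Q, @EAQECC K #|F| N k d c Q.
Proof.
move=> d_gt0 rkC rkD rkCD C_d D_d.
have [X XE] : exists X : 'M_(k, N), (X :=: C :\: D)%MS.
  apply: eqmx_basis; apply/eqP.
  by rewrite -(eqn_add2l w) -{1}rkCD mxrank_cap_compl rkC addnC.
have [Y YE] : exists Y : 'M_(c, N), (Y :=: D :\: C)%MS.
  apply: eqmx_basis; apply/eqP.
  by rewrite -(eqn_add2l w) -{1}rkCD capmxC mxrank_cap_compl rkD.
have [W WE] := eqmx_basis rkCD.
have CE : (col_mx X W :=: C)%MS.
  apply: (eqmx_trans (eqmx_sym (addsmxE _ _))).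
  by apply: (eqmx_trans (adds_eqmx XE WE)); apply: addsmx_diff_cap_eq.
have DE : (col_mx W Y :=: D)%MS.
  apply: (eqmx_trans (eqmx_sym (addsmxE _ _))); rewrite addsmxC.
  apply: (eqmx_trans (adds_eqmx YE WE)); rewrite capmxC.
  exact: addsmx_diff_cap_eq.
apply: (@EAQECC_matrices K F N k w c a d e X W Y) => // [|v|v].
(* The [k + w + c] rows span [C + D], whose dimension is [(k + w) + (w + c) - w]. *)
- have CD_sub : (C + D <= col_mx (col_mx X W) Y)%MS.
    set M := col_mx (col_mx X W) Y.
    have XWM : (col_mx X W <= M)%MS.
      by apply: submx_trans (addsmxSl _ Y) _; rewrite addsmxE.
    have YM : (Y <= M)%MS.
      by apply: submx_trans (addsmxSr (col_mx X W) _) _; rewrite addsmxE.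
    by move: XWM; rewrite addsmx_sub -CE -DE !col_mx_sub YM andbT => /andP[-> ->].
  rewrite /row_free eqn_leq rank_leq_row (leq_trans _ (mxrankS CD_sub)) //.
  by rewrite -(leq_add2r w) -{3}rkCD mxrank_sum_cap rkC rkD addnAC addnA.
- by rewrite CE; apply: C_d.
move=> vWY; apply: D_d; have /submxP[Z ->] : (D <= col_mx W Y)%MS by rewrite DE.
by rewrite trmx_mul mulmxA vWY mul0mx.
Qed.

(** * Permutations with a prescribed number of orbits *)

Lemma cycle_fibers r t : (t <= r)%N -> ((0 < r)%N -> (0 < t)%N) ->
  exists (pi : {perm 'I_r}) (phi : 'I_r -> 'I_t) (psi : 'I_t -> 'I_r),
    [/\ cancel psi phi, forall j, phi (pi j) = phi j
      & forall (T : Type) (u : 'I_r -> T), (forall j, u (pi j) = u j) ->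
          forall j, u (psi (phi j)) = u j].
Proof.
case: t => [|t] tr t_gt0.
  have r0 : r = 0%N by lia.
  by subst r; exists 1%g, id, id; split=> // -[].
(* With [m = r - t.+1], the permutation is the cycle [0 -> 1 -> ... -> m -> 0] and fixes everything
   above [m]: [t.+1] orbits in all. *)
have pi_lt (j : 'I_r) : ((if j < r - t.+1 then j.+1
    else if j == r - t.+1 :> nat then 0 else j) < r)%N.
  by have := ltn_ord j; case: ifP => // ?; [lia | case: ifP => // ?; lia].
have pi_inj : injective (fun j => Ordinal (pi_lt j)).
  move=> i j [] ij; apply: val_inj => /=; move: ij.
  by do !case: ifP => ?; lia.
(* [phi] numbers the orbits, truncated subtraction sending the whole cycle to 0; [psi] picks the
   largest element of each orbit. *)
have phi_lt (j : 'I_r) : (j - (r - t.+1) < t.+1)%N by have := ltn_ord j; lia.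
have psi_lt (i : 'I_t.+1) : (i + (r - t.+1) < r)%N by have := ltn_ord i; lia.
exists (perm pi_inj), (fun j => Ordinal (phi_lt j)), (fun i => Ordinal (psi_lt i)).
split=> [i|j|T u u_pi j]; try apply: val_inj => /=; first lia.
  by rewrite permE /=; do !case: ifP => ?; lia.
have r_gt0 : (0 < r)%N by lia.
have u_low m : (m <= r - t.+1)%N ->
    forall i : 'I_r, i = m :> nat -> u i = u (Ordinal r_gt0).
  elim: m => [|m IHm] m_le i im; first by congr u; apply: val_inj.
  have m_lt : (m < r)%N by lia.
  rewrite -(IHm _ (Ordinal m_lt)) ?(ltnW m_le) // -(u_pi (Ordinal m_lt)).
  congr u; apply: val_inj.
  by rewrite permE /= m_le.
have [j_low|j_high] := leqP j (r - t.+1); last by congr u; apply: val_inj => /=; lia.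
by rewrite [RHS](u_low j) // (u_low (r - t.+1)%N) //=; lia.
Qed.

Lemma perm_extension (r n : nat) (iota : 'I_r -> 'I_n) (pi : {perm 'I_r}) :
    injective iota ->
  exists s : {perm 'I_n}, (forall j, s (iota j) = iota (pi j)) /\
    (forall l, (forall j, iota j != l) -> s l = l).
Proof.
move=> iota_inj.
pose f l := if [pick j | iota j == l] is Some j then iota (pi j) else l.
have fI j : f (iota j) = iota (pi j).
  by rewrite /f; case: pickP => [j' /eqP/iota_inj-> //|/(_ j)]; rewrite eqxx.
have fE l : (forall j, iota j != l) -> f l = l.
  by rewrite /f; case: pickP => // j /eqP <- /(_ j); rewrite eqxx.
have f_inj : injective f.
  have caseI l : (exists j, l = iota j) \/ (forall j, iota j != l).
    case: (pickP (fun j => iota j == l)) => [j /eqP <-|noj]; first by left; exists j.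
    by right=> j; rewrite noj.
  move=> l l'; have [[j ->]|lI] := caseI l; have [[j' ->]|l'I] := caseI l'.
  - by rewrite !fI => /iota_inj/perm_inj->.
  - by rewrite fI (fE l') // => E; have := l'I (pi j); rewrite E eqxx.
  - by rewrite fI fE // => E; have := lI (pi j'); rewrite E eqxx.
  - by rewrite !fE.
by exists (perm f_inj); split=> [j|l lI]; rewrite permE ?fI ?fE.
Qed.

Lemma weight_row_mx (F : finFieldType) m n (v : 'rV[F]_m) (w : 'rV[F]_n) :
  (weight v <= weight (row_mx v w))%N.
Proof.
rewrite /weight -(card_imset _ (@lshift_inj m n)); apply/subset_leq_card/subsetP => l.
by case/imsetP => i; rewrite !inE => vi ->; rewrite row_mxEl.
Qed.

Lemma weight_col_perm (F : finFieldType) n (s : {perm 'I_n}) (v : 'rV[F]_n) :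
  weight (col_perm s v) = weight v.
Proof.
rewrite /weight -(card_imset _ (@perm_inj _ s)); apply: eq_card => l.
apply/imsetP/idP => [[k]|]; rewrite !inE ?mxE; first by move=> vi ->.
by move=> vl; exists (s^-1%g l); rewrite ?inE ?mxE permKV.
Qed.

(** * A systematic parity-check matrix, its permutation and the extended codes *)

Section DualContaining.
Variables (F : finFieldType) (r n : nat) (H : 'M[F]_(r, n)) (iota : 'I_r -> 'I_n).
Hypothesis HI : forall i j, H i (iota j) = (i == j)%:R.
Hypothesis HH : H *m H^T = 0.

Lemma info_set_inj : injective iota.
Proof.
move=> i j ij; apply/eqP; have := HI i j; rewrite -ij HI eqxx; case: eqP => // _.
by move/eqP; rewrite oner_eq0.
Qed.

Lemma info_mulmx (u : 'rV_r) j : (u *m H) 0 (iota j) = u 0 j.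
Proof.
by rewrite mxE; under eq_bigr do rewrite HI; rewrite sum_delta.
Qed.

Lemma parity_row_free : row_free H.
Proof.
apply: inj_row_free => u uH; apply/rowP => j.
by rewrite -info_mulmx uH !mxE.
Qed.

Variables (pi : {perm 'I_r}) (s : {perm 'I_n}).
Hypothesis sI : forall j, s (iota j) = iota (pi j).
Hypothesis sE : forall l, (forall j, iota j != l) -> s l = l.

Let Hs := col_perm s H.

Lemma permuted_row_free : row_free Hs.
Proof.
rewrite /row_free /Hs col_permE mxrankMfree ?row_free_unit ?unitmx_perm //.
exact: parity_row_free.
Qed.

(** Permuting changes [H] only on the information set, where [H] is the identity. The change is
    [(P - 1) E], with [P] a permutation matrix and the rows of [E] unit vectors at the [iota j];
    then [H H^T = 0] and [E H^T = 1] leave [P - 1]. Thus [u *m Hs] is in the kernel of [H^T] exactly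
    when [pi] fixes [u]. *)
Lemma permuted_gram (u : 'rV_r) j : (u *m Hs *m H^T) 0 j = u 0 (pi j) - u 0 j.
Proof.
pose E : 'M[F]_(r, n) := \matrix_(j, l) (iota j == l)%:R.
have HsE : Hs = H + (\matrix_(i, j) ((i == pi j)%:R - (i == j)%:R)) *m E.
  apply/matrixP => i l; rewrite !mxE.
  under eq_bigr do rewrite !mxE.
  have [j' /eqP <-|noj] := pickP (fun j => iota j == l).
    rewrite sI !HI (bigD1 j') //= eqxx mulr1 big1 ?addr0 ?subrKC // => j'' jj.
    by rewrite (inj_eq info_set_inj) (negPf jj) mulr0.
  rewrite sE => [|j']; last by rewrite noj.
  by rewrite big1 ?addr0 // => j' _; rewrite noj mulr0.
have EH : E *m H^T = 1%:M.
  apply/matrixP => i l; rewrite !mxE (eq_bigr (fun k => H l k * (k == iota i)%:R)).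
    by rewrite sum_delta HI eq_sym.
  by move=> k _; rewrite !mxE mulrC eq_sym.
rewrite -mulmxA HsE mulmxDl HH add0r -mulmxA EH mulmx1 mxE.
rewrite (eq_bigr (fun i => u 0 i * (i == pi j)%:R - u 0 i * (i == j)%:R)).
  by rewrite sumrB !sum_delta.
by move=> i _; rewrite mxE mulrBr.
Qed.

Lemma permuted_info (u : 'rV_r) j : (u *m Hs) 0 (iota j) = u 0 (pi j).
Proof.
by rewrite -[RHS]info_mulmx -sI !mxE; apply: eq_bigr => i _; rewrite mxE.
Qed.

(** [kermx H^T] is square, hence [n] rows for a space of dimension [n - r]. *)
Definition extended_code (f : 'cV[F]_n) : 'M[F]_(n, n + 1) :=
  kermx H^T *m row_mx 1%:M f.

Definition extended_dual (h : 'rV[F]_n) : 'M[F]_(r + 1, n + 1) :=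
  col_mx (row_mx Hs 0) (row_mx h 1%:M).

Lemma extended_codeP f (v : 'rV_(n + 1)) :
  (v <= extended_code f)%MS ->
  exists2 x : 'rV_n, x *m H^T = 0 & v = row_mx x (x *m f).
Proof.
case/submxP => u ->; exists (u *m kermx H^T); first by rewrite -mulmxA mulmx_ker mulmx0.
by rewrite mulmxA mul_mx_row mulmx1.
Qed.

Lemma extended_dualP h (v : 'rV_(n + 1)) :
  (v <= extended_dual h)%MS ->
  exists (u : 'rV_r) (b : 'rV_1), v = row_mx (u *m Hs + b *m h) b.
Proof.
case/submxP => u ->; exists (lsubmx u), (rsubmx u).
rewrite -{1}[u]hsubmxK mul_row_col !mul_mx_row add_row_mx mulmx0 add0r.
by rewrite mulmx1.
Qed.

Lemma rank_extended_code f : \rank (extended_code f) = (n - r)%N.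
Proof.
rewrite mxrankMfree ?mxrank_ker ?mxrank_tr ?(eqP parity_row_free) //.
apply: inj_row_free => v; rewrite mul_mx_row mulmx1 => /eqP.
by rewrite row_mx_eq0 => /andP[/eqP].
Qed.

Lemma rank_extended_dual h : \rank (extended_dual h) = (r + 1)%N.
Proof.
apply/eqP/inj_row_free => v; rewrite -[v]hsubmxK mul_row_col !mul_mx_row.
rewrite add_row_mx mulmx0 add0r mulmx1 => /eqP.
rewrite row_mx_eq0 => /andP[uh /eqP b0].
move: uh; rewrite b0 mul0mx addr0 => /eqP uHs.
rewrite (row_free_inj permuted_row_free (etrans uHs (esym (mul0mx _ _)))).
by rewrite row_mx0.
Qed.

Variable d : nat.
Hypothesis Hd : forall v : 'rV_n, v *m H^T = 0 -> (weight v < d)%N -> v = 0.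

Lemma extended_code_dist f (v : 'rV_(n + 1)) :
  (v <= extended_code f)%MS -> (weight v < d)%N -> v = 0.
Proof.
case/extended_codeP => x xH -> wt; rewrite (Hd xH) ?mul0mx ?row_mx0 //.
exact: leq_ltn_trans (weight_row_mx _ _) wt.
Qed.

(** Undoing the permutation turns the first [n] coordinates into a word of the kernel of [H^T] of
    weight below [d], hence 0; the row [(h, 1)] then kills the last coordinate. *)
Lemma extended_dual_dist h (v : 'rV_(n + 1)) :
  v *m (extended_dual h)^T = 0 -> (weight v < d)%N -> v = 0.
Proof.
rewrite -[v]hsubmxK; move: (lsubmx v) (rsubmx v) => x b.
rewrite tr_col_mx !tr_row_mx mul_mx_row !mul_row_col trmx0 trmx1 mulmx0 mulmx1 addr0.
move/eqP; rewrite row_mx_eq0 => /andP[/eqP xHs /eqP xb] wt.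
have x0 : col_perm s^-1%g x = 0.
  apply: Hd; last by rewrite weight_col_perm (leq_ltn_trans (weight_row_mx _ _) wt).
  rewrite col_permE -mulmxA invgK -(trmxK (perm_mx s)) -trmx_mul tr_perm_mx.
  by rewrite -col_permE.
have x0' : x = 0.
  by rewrite -(col_perm1 x) -(mulgV s) col_permM x0 col_permE mul0mx.
by move: xb; rewrite x0' mul0mx add0r => ->; rewrite row_mx0.
Qed.

End DualContaining.

(** * Intersections of prescribed dimension *)

Section ParityCheck.
Variables (F : finFieldType) (r n : nat) (H : 'M[F]_(r, n)) (iota : 'I_r -> 'I_n).
Hypothesis HI : forall i j, H i (iota j) = (i == j)%:R.
Hypothesis HH : H *m H^T = 0.
Variable d : nat.
Hypothesis Hd : forall v : 'rV_n, v *m H^T = 0 -> (weight v < d)%N -> v = 0.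
Hypothesis d_gt0 : (0 < d)%N.

(** The row space of [H] lies in its dual, of dimension [n - r]. *)
Lemma redundancy_le : (r + r <= n)%N.
Proof.
have rkH := eqP (parity_row_free HI).
have : (H <= kermx H^T)%MS by apply/sub_kermxP.
move/mxrankS; rewrite mxrank_ker mxrank_tr rkH.
have := rank_leq_col H; rewrite rkH; lia.
Qed.

(** With [f = h = 0], the common words are the [(u *m Hs, 0)] with [u] fixed by [pi], that is,
    constant on the [t] orbits. *)
Lemma rank_cap_partial t : (t <= r)%N -> ((0 < r)%N -> (0 < t)%N) ->
  exists (pi : {perm 'I_r}) (s : {perm 'I_n}), [/\ forall j, s (iota j) = iota (pi j),
    forall l, (forall j, iota j != l) -> s l = l
  & \rank (extended_code H 0 :&: extended_dual H s 0)%MS = t].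
Proof.
move=> tr t_gt0; have [pi [phi [psi [phiK phi_pi pi_inv]]]] := cycle_fibers tr t_gt0.
have [s [sI sE]] := perm_extension pi (info_set_inj HI).
exists pi, s; split=> //; set Hs := col_perm s H.
(* The rows of [B] are the indicators of the orbits. *)
pose B : 'M[F]_(t, r) := \matrix_(i, j) (phi j == i)%:R.
have mulB (u : 'rV_t) j : (u *m B) 0 j = u 0 (phi j).
  rewrite mxE (eq_bigr (fun i => u 0 i * (i == phi j)%:R)) ?sum_delta // => i _.
  by rewrite mxE eq_sym.
have B_free : row_free B.
  by apply: inj_row_free => u uB; apply/rowP => i; rewrite -(phiK i) -mulB uB !mxE.
pose Hs0 : 'M_(r, n + 1) := row_mx Hs 0.
have Hs0_free : row_free Hs0.
  apply: inj_row_free => u; rewrite mul_mx_row => /eqP.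
  rewrite row_mx_eq0 => /andP[/eqP uHs _].
  apply: (row_free_inj (permuted_row_free HI s)).
  by rewrite mul0mx.
transitivity (\rank (B *m Hs0)); last by rewrite mxrankMfree //; apply/eqP.
apply/eqmx_rank/andP; split; apply/rV_subP => v.
  rewrite sub_capmx => /andP[/extended_codeP[x xH ->] /extended_dualP[u [b]]].
  rewrite !mulmx0 addr0 => /eq_row_mx[xE _].
  have u_pi j : u 0 (pi j) = u 0 j.
    apply/eqP; rewrite -subr_eq0 -(permuted_gram HI HH sI sE) -xE xH.
    by rewrite mxE.
  have uB : u = (\row_i u 0 (psi i)) *m B.
    by apply/rowP => j; rewrite mulB mxE (pi_inv _ (fun j => u 0 j)).
  have -> : row_mx x 0 = u *m Hs0 by rewrite mul_mx_row mulmx0 xE.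
  by rewrite uB -mulmxA submxMl.
case/submxP => w ->; rewrite mulmxA sub_capmx; apply/andP; split.
  have uH : w *m B *m Hs *m H^T = 0.
    by apply/rowP => j; rewrite (permuted_gram HI HH sI sE) !mulB phi_pi subrr mxE.
  have -> : w *m B *m Hs0 = w *m B *m Hs *m row_mx 1%:M 0.
    by rewrite !mul_mx_row mulmx1 !mulmx0.
  by apply: submxMr; apply/sub_kermxP.
have -> : w *m B *m Hs0 = row_mx (w *m B) 0 *m extended_dual H s 0.
  by rewrite mul_row_col mul0mx addr0.
exact: submxMl.
Qed.

Lemma rank_cap_zero : (0 < r)%N ->
  exists (pi : {perm 'I_r}) (s : {perm 'I_n}) f h,
  [/\ forall j, s (iota j) = iota (pi j),
    forall l, (forall j, iota j != l) -> s l = l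
  & \rank (extended_code H f :&: extended_dual H s h)%MS = 0%N].
Proof.
move=> r_gt0; pose j0 := Ordinal r_gt0.
(* [r_gt0], read as [1 <= r], asks for a single orbit. *)
have [pi [phi [psi [phiK phi_pi pi_inv]]]] := cycle_fibers r_gt0 (fun=> isT).
have [s [sI sE]] := perm_extension pi (info_set_inj HI).
exists pi, s, (\col_l (l == iota j0)%:R), (\row_l (l == iota j0)%:R); split=> //.
set f := (\col_l _); set h := (\row_l _); set Hs := col_perm s H.
apply/eqP; rewrite mxrank_eq0; apply/rowV0P => v.
rewrite sub_capmx => /andP[/extended_codeP[x xH ->] /extended_dualP[u [b]]].
case/eq_row_mx => xE xf; rewrite -/Hs in xE.
have hH j : (h *m H^T) 0 j = (j == j0)%:R.
  rewrite mxE (eq_bigr (fun l => H j l * (l == iota j0)%:R)).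
    by rewrite sum_delta HI.
  by move=> l _; rewrite !mxE mulrC.
(* Add up the coordinates of the syndrome of [x]: the differences [u 0 (pi j) - u 0 j] cancel over
   all [j], and [h] contributes [b] once. *)
have b0 : b = 0.
  have : \sum_j (x *m H^T) 0 j = 0 by rewrite xH big1 // => j _; rewrite mxE.
  rewrite xE mulmxDl (eq_bigr (fun j => (u 0 (pi j) - u 0 j) + b 0 0 * (j == j0)%:R)).
    rewrite big_split /= sum_delta sumrB.
    rewrite [X in X - _](_ : _ = \sum_j u 0 j) ?subrr ?add0r => [b0|]; last first.
      by rewrite [RHS](reindex_inj (@perm_inj _ pi)).
    by apply/matrixP => i j; rewrite !ord1 b0 mxE.
  move=> j _; rewrite mxE (permuted_gram HI HH sI sE) -mulmxA; congr (_ + _).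
  by rewrite mxE big_ord1 hH.
have u_const j : u 0 j = u 0 (pi j0).
  have u_pi i : u 0 (pi i) = u 0 i.
    apply/eqP; rewrite -subr_eq0 -(permuted_gram HI HH sI sE).
    by move: xH; rewrite xE b0 mul0mx addr0 => ->; rewrite mxE.
  rewrite -(pi_inv _ (fun j => u 0 j) u_pi j).
  rewrite -(pi_inv _ (fun j => u 0 j) u_pi (pi j0)).
  by rewrite !ord1.
(* [f] reads the coordinate [iota j0] of [x], which is the constant value of [u]; by [xf] it equals
   [b], which is 0. *)
have u0 : u = 0.
  apply/rowP => j; rewrite u_const -(permuted_info HI sI) -/Hs.
  have -> : u *m Hs = x by rewrite xE b0 mul0mx addr0.
  move/rowP/(_ 0): xf; rewrite b0 mxE (eq_bigr (fun l => x 0 l * (l == iota j0)%:R)).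
    by rewrite sum_delta => ->; rewrite !mxE.
  by move=> l _; rewrite !mxE.
by rewrite xf b0 xE u0 b0 !mul0mx addr0 row_mx0.
Qed.

Lemma EAQECC_parity (K : numClosedFieldType) c :
    (0 < c)%N -> (c <= r + 1)%N ->
  exists Q, @EAQECC K #|F| (n + 1) (2 * (n - r) + c - (n + 1)) d c Q.
Proof.
move=> c_gt0 c_le; have rn := redundancy_le.
have [pi [s [f [h [sI sE cap]]]]] : exists (pi : {perm 'I_r}) (s : {perm 'I_n}) f h,
    [/\ forall j, s (iota j) = iota (pi j),
        forall l, (forall j, iota j != l) -> s l = l
      & \rank (extended_code H f :&: extended_dual H s h)%MS = (r + 1 - c)%N].
  (* If [r = 0] then [c = 1], and [rank_cap_partial] applies with no orbit at all. *)
  have [/andP[r_gt0 /eqP->]|c_small] := boolP ((0 < r)%N && (c == r + 1)%N).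
    by rewrite subnn; apply: rank_cap_zero.
  have [||pi [s [sI sE cap]]] := @rank_cap_partial (r + 1 - c); try lia.
  by exists pi, s, 0, 0.
(* There are [2 * (r + 1 - c)] ancillas; [2 * r <= n] and [0 < c] keep the truncated subtraction
   exact. *)
have e : (2 * (n - r) + c - (n + 1) + 2 * (r + 1 - c) + c = n + 1)%N by lia.
apply: (EAQECC_codes K e d_gt0 _ _ cap).
- by rewrite (rank_extended_code HI); lia.
- by rewrite (rank_extended_dual HI); lia.
- exact: extended_code_dist.
- exact: extended_dual_dist.
Qed.

End ParityCheck.

(** A parity-check matrix [L] has [n - k] independent columns; multiplying by the inverse of that
    minor puts the identity there and preserves the kernel. *)
Lemma parity_check_systematic (F : fieldType) n k (C : {vspace 'rV[F]_n}) :
    \dim C = k ->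
  exists (H : 'M[F]_(n - k, n)) (iota : 'I_(n - k) -> 'I_n),
    (forall i j, H i (iota j) = (i == j)%:R) /\
    (forall v : 'rV_n, (v \in C) = (v *m H^T == 0)).
Proof.
move=> dimC; pose G : 'M[F]_(\dim C, n) := \matrix_i (vbasis C)`_i.
have GC (v : 'rV_n) : (v <= G)%MS = (v \in C).
  apply/idP/idP => [/submxP[u ->]|vC].
    rewrite mulmx_sum_row; apply: memv_suml => i _; rewrite rowK memvZ //.
    by rewrite vbasis_mem // mem_nth // size_tuple.
  rewrite (coord_vbasis vC) summx_sub // => i _; rewrite scalemx_sub //.
  by rewrite -(rowK (fun i : 'I__ => (vbasis C)`_i)) row_sub.
have rkG : \rank G = k.
  rewrite -dimC; apply/eqP/inj_row_free => u; rewrite mulmx_sum_row => uG.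
  apply/rowP => i; rewrite mxE.
  have /freeP/(_ (fun j => u 0 j)) := basis_free (vbasisP C); apply.
  by rewrite -[RHS]uG; apply: eq_bigr => j _; rewrite rowK.
have [L LE] : exists L : 'M_(n - k, n), (L :=: (cokermx G)^T)%MS.
  by apply: eqmx_basis; rewrite mxrank_tr mxrank_coker rkG.
have L_free : row_free L by rewrite /row_free LE mxrank_tr mxrank_coker rkG.
have Lt_full : row_full L^T by rewrite /row_full mxrank_tr.
pose iota := fullrankfun Lt_full.
pose M := rowsub iota L^T.
have Mu : M \in unitmx by rewrite -row_full_unit fullrowsub_full.
have LvE (v : 'rV_n) : (v \in C) = (v *m L^T == 0).
  rewrite -GC submxE; apply/eqP/eqP => [vG|vL].
    have /submxP[Z ->] : (L <= (cokermx G)^T)%MS by rewrite LE.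
    by rewrite trmx_mul trmxK mulmxA vG mul0mx.
  have /submxP[Z ZE] : ((cokermx G)^T <= L)%MS by rewrite LE.
  by rewrite -[cokermx G]trmxK ZE trmx_mul mulmxA vL mul0mx.
exists (invmx M^T *m L), iota; split=> [i j|v].
  have /matrixP/(_ i j) : invmx M^T *m M^T = 1%:M by rewrite mulVmx ?unitmx_tr.
  by rewrite !mxE => <-; apply: eq_bigr => l _; rewrite !mxE.
rewrite LvE trmx_mul mulmxA trmx_inv trmxK.
rewrite -[X in _ = (_ == X)](mul0mx _ (invmx M)) (inj_eq (row_free_inj _)) //.
by rewrite row_free_unit unitmx_inv.
Qed.

Local Open Scope complex_scope.

Theorem proposition4p3 (R : realType) (q : nat) (F : finFieldType)
    (cardF : #|F| = q) (n k d c : nat) (C : {vspace 'rV[F]_n})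
    (codeC : linear_code C k d) (dualC : {subset euclidean_dual C <= C})
    (c_gt0 : (0 < c)%N) (c_le : (c <= n - k + 1)%N)
    (cond : [\/ q = 2%N /\ odd c, q = 3%N /\ ~~ (3 %| c)%N | (4 <= q)%N]) :
  exists2 d' : nat, d' = d \/ d' = (d + 1)%N &
    exists Q : 'M[R[i]]_(qdim q (n + 1) * qdim q c),
      @EAQECC R[i] q (n + 1) (2 * k + c - (n + 1)) d' c Q.
Proof.
exists d; first by left.
move: codeC => [dimC [[u0 [v0 [u0C v0C uv0 d_uv]]] d_min]]; subst q.
have [H [iota [HI HC]]] := parity_check_systematic dimC.
have k_le : (k <= n)%N.
  by rewrite -dimC; have := dimvS (subvf C); rewrite dimvf /dim /= mul1n.
(* A row of [H] is orthogonal to [C], so it lies in the dual, hence in [C], which is the kernel of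
   [H^T]. *)
have HH : H *m H^T = 0.
  apply/row_matrixP => i; rewrite row_mul row0; apply/eqP; rewrite -HC; apply: dualC.
  rewrite inE; apply/forall_inP => w; rewrite HC => /eqP/rowP/(_ i) wH.
  apply/eqP; transitivity ((w *m H^T) 0 i); last by rewrite wH mxE.
  by rewrite [RHS]mxE; apply: eq_bigr => j _; rewrite !mxE mulrC.
(* The weight of [v] is its distance to the zero word. *)
have Hd (v : 'rV_n) : v *m H^T = 0 -> (weight v < d)%N -> v = 0.
  move=> vH wt; apply/eqP; apply: contraTT wt => v_neq0; rewrite -leqNgt.
  apply: leq_trans (d_min v 0 _ _ v_neq0) _; rewrite ?mem0v ?HC ?vH //.
  by apply/subset_leq_card/subsetP => j; rewrite !inE mxE.
have d_gt0 : (0 < d)%N.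
  rewrite -d_uv; apply/card_gt0P; apply/existsP; apply: contraNT uv0.
  rewrite negb_exists => /forallP uv; apply/eqP/rowP => j.
  by apply/eqP; have := uv j; rewrite inE negbK.
have := EAQECC_parity HI HH Hd d_gt0 R[i] c_gt0 c_le.
by rewrite subKn.
Qed.
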